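(* The limit $$\lim_{n\to\infty}\frac{\mathcal{C}(\mathbb{Z}/n\mathbb{Z})}{\varphi(n)}$$ does not exist. Moreover, $$\liminf_{n\to\infty}\frac{\mathcal{C}(\mathbb{Z}/n\mathbb{Z})}{\varphi(n)}=1,\qquad \limsup_{n\to\infty}\frac{\mathcal{C}(\mathbb{Z}/n\mathbb{Z})}{\varphi(n)}=\infty.$$
   Context: For an element $x$ of a finite group $G$, $\operatorname{ord}(x)$ denotes its order (for $\mathbb{Z}/n\mathbb{Z}$, the additive order). A nonempty subset $S\subseteq G$ is called a Chowla set if $\operatorname{ord}(x)>|S|$ for every $x\in S$. Define $\mathcal{C}(G)=\max\{|S|:S\subseteq G\text{ is a Chowla set}\}$. $\varphi$ is Euler's totient function. The variable $n$ ranges over integers $n\ge 2$. *)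

(* Defs.v *)
From mathcomp Require Import all_boot all_order all_algebra all_fingroup.
From mathcomp Require Import all_classical all_reals all_analysis.

Set Implicit Arguments.
Unset Strict Implicit.
Unset Printing Implicit Defensive.

Local Open Scope ring_scope.

Definition chowla_set (gT : finGroupType) (S : {set gT}) : bool :=
  (S != finset.set0) && [forall x in S, (#|S| < #[x]%g)%N].

(* The trivial group has no Chowla set, and gets the value 0. *)
Definition chowla_number (gT : finGroupType) : nat :=
  (\max_(S : {set gT} | chowla_set S) #|S|)%N.

(* The group operation of the finGroupType 'Z_n is addition modulo n; 'Z_n is
   the integers modulo n only for 1 < n. *)
Definition chowla_ratio (R : realType) (n : nat) : R :=
  (chowla_number 'Z_n)%:R / (totient n)%:R.

(* Main.v *)
Require Import Defs.
From mathcomp Require Import all_boot all_order all_algebra all_fingroup.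
From mathcomp Require Import all_classical all_reals all_analysis.
From mathcomp Require Import cyclic.

(** Write C for the Chowla number of the integers modulo n and H_T for the
    harmonic sum 1 + 1/2 + ... + 1/T.

    The generators form a Chowla set, because they all have order n and the
    neutral element is not one of them; hence C >= phi(n). As no Chowla set
    fills the group, C <= n - 1, which is phi(n) when n is prime. So the ratio
    is at least 1 everywhere and equals 1 at the primes: its liminf is 1.

    For the limsup, let S_T be the set of the elements of order at least n / T.
    If g^2 divides n for all g <= T, then phi(n / g) = phi(n) / g for these g,
    and counting the elements of order n / g for each g <= T gives
      |S_T| = phi(n) H_T              (card_large_order_set).
    By definition of S_T, it is a Chowla set as soon as T |S_T| < n, that is,
    as soon as T phi(n) H_T < n, and it then shows that C / phi(n) >= H_T.
    The inequality T phi(n) H_T < n is arranged with the same count: if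
    H_B > T H_T and n is also divisible by the squares up to B, then
    n >= |S_B| = phi(n) H_B > T phi(n) H_T. Since the harmonic series
    diverges, such a B exists for every T, and H_T is as large as wanted.

    A convergent sequence has equal liminf and limsup, so there is no limit,
    not even an infinite one. *)

Import Order.TTheory GRing.Theory Num.Theory.

Local Open Scope ring_scope.

(** When g divides m, being coprime to g * m is being coprime to m, a condition
    of period m, and [0, g * m) consists of g periods. *)
Lemma totientM_dvd (g m : nat) :
  (g %| m -> totient (g * m) = g * totient m)%N.
Proof.
move=> dvd_gm.
have coprime_gm d : coprime (g * m) d = coprime m d.
  rewrite coprimeMl andb_idl // => co_md.
  exact: coprime_dvdl dvd_gm co_md.
rewrite !totient_count_coprime.
under eq_bigr do rewrite coprime_gm.
elim: {dvd_gm coprime_gm}g => [|g IHg]; first by rewrite !mul0n big_geq.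
rewrite mulSn (@big_cat_nat _ _ _ m) ?leq_addr //= mulSn -IHg.
congr (_ + _)%N; rewrite -{1}[m]add0n big_addn addKn.
by apply: eq_bigr => d _; rewrite /coprime gcdnDr.
Qed.

(** A cyclic group has one subgroup of each order d dividing its order, and the
    elements of order d are the generators of that subgroup. *)
Lemma card_order_cyclic (gT : finGroupType) (G : {group gT}) (d : nat) :
  cyclic G -> (d %| #|G|)%N ->
  #|[set x in G | #[x]%g == d]| = totient d.
Proof.
move=> cycG; case/cyclicP: (cycG) => x defG; rewrite defG -orderE => dvd_d.
have [a aG oa] : exists2 a, a \in G & #[a]%g = d.
  exists (x ^+ (#[x] %/ d))%g; first by rewrite defG mem_cycle.
  by rewrite orderXdiv ?dvdn_div // divnA // mulKn // order_gt0.
rewrite -oa totient_gen -defG; apply: eq_card => y; rewrite !inE /generator.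
apply/andP/eqP => [[yG /eqP oy]|eq_ay].
  by apply/eqP; rewrite (eq_subG_cyclic cycG) ?cycle_subG // -!orderE oy.
have yG : y \in G by rewrite -cycle_subG -eq_ay cycle_subG.
by rewrite yG /order eq_ay.
Qed.

Definition large_order_set (gT : finGroupType) (T : nat) : {set gT} :=
  [set x : gT | (#|gT| <= #[x]%g * T)%N].

(** The elements of order at least n / T are those of order n / g for some
    g <= T. There are phi(n / g) of them, and phi(n / g) = phi(n) / g since
    g divides n / g. *)
Lemma card_large_order_set (R : realType) (gT : finGroupType) (T : nat) :
  cyclic [set: gT]%G ->
  (forall g : nat, (0 < g <= T)%N -> (g * g %| #|gT|)%N) ->
  #|large_order_set gT T|%:R = (totient #|gT|)%:R * series harmonic T :> R.
Proof.
move=> cycG sqrT.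
have -> : #|large_order_set gT T| = (\sum_(0 <= i < T)
    #|[set x in [set: gT]%G | #[x]%g == (#|gT| %/ i.+1)%N]|)%N.
  rewrite -sum1_card big_mkcond /=.
  under [RHS]eq_bigr do rewrite -sum1_card big_mkcond /=.
  rewrite exchange_big /=; apply: eq_bigr => x _.
  have /dvdnP[e De] : (#[x]%g %| #|gT|)%N.
    by rewrite -cardsT order_dvdG ?inE.
  have o_gt0 := order_gt0 x.
  have e_gt0 : (0 < e)%N.
    by move: (cardG_gt0 [set: gT]%G); rewrite cardsT De muln_gt0 => /andP[].
  (* x has order n / e, so only the term of index i = e - 1 counts it. *)
  transitivity (\sum_(0 <= i < T) (e == i.+1))%N; last first.
    rewrite !big_nat; apply: eq_bigr => i /= iT; rewrite !inE /=.
    have dvd_i : (i.+1 %| #|gT|)%N :=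
      dvdn_trans (dvdn_mulr _ (dvdnn _)) (sqrT i.+1 iT).
    by rewrite eqn_div // De mulnC eqn_pmul2r // eq_sym; case: eqP.
  rewrite finset.inE De mulnC leq_pmul2l //.
  elim: T {sqrT} => [|T IHT]; first by rewrite big_geq // leqNgt e_gt0.
  rewrite big_nat_recr //= -IHT leq_eqVlt ltnS.
  by case: eqP => [->|_]; rewrite ?ltnn ?addn0.
rewrite natr_sum seriesEnat mulr_sumr !big_nat /=; apply: eq_bigr => i /= iT.
have sqi := sqrT i.+1 iT.
have dvd_i := dvdn_trans (dvdn_mulr i.+1 (dvdnn i.+1)) sqi.
rewrite card_order_cyclic ?cardsT //; last exact: dvdn_div.
have dvd_i2 : (i.+1 %| #|gT| %/ i.+1)%N by rewrite dvdn_divRL.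
rewrite -[in RHS](divnK dvd_i) mulnC totientM_dvd // natrM mulrAC.
by rewrite divff ?mul1r ?pnatr_eq0.
Qed.

Lemma leq_chowla_number (gT : finGroupType) (S : {set gT}) :
  chowla_set S -> (#|S| <= chowla_number gT)%N.
Proof. exact: bigop.leq_bigmax_cond. Qed.

(** An element of a Chowla set has order larger than the set and at most the
    order of the group. *)
Lemma chowla_number_le_predn_card (gT : finGroupType) :
  (chowla_number gT <= #|gT|.-1)%N.
Proof.
apply/bigmax_leqP => S /andP[/set0Pn[x xS] /forall_inP/(_ x xS) ltSx].
rewrite -ltnS prednK ?(leq_trans ltSx) //.
  by rewrite -cardsT subset_leq_card ?subsetT.
by rewrite -cardsT cardG_gt0.
Qed.

(** The witness is the set of generators, which have the order of the group and
    leave out at least the neutral element. *)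
Lemma totient_le_chowla_number (gT : finGroupType) :
  cyclic [set: gT]%G -> (1 < #|gT|)%N -> (totient #|gT| <= chowla_number gT)%N.
Proof.
move=> cycG gT_gt1.
pose S := [set x in [set: gT]%G | #[x]%g == #|gT|].
have cS : #|S| = totient #|gT| by rewrite card_order_cyclic ?cardsT.
rewrite -cS; apply: leq_chowla_number; apply/andP; split.
  by rewrite -card_gt0 cS totient_gt0 ltnW.
apply/forall_inP => x; rewrite !inE /= => /eqP ->.
rewrite -cardsT; apply: proper_card; rewrite properT.
apply/eqP => defS; have : (1%g : gT) \in S by rewrite defS inE.
by rewrite !inE order1 /= eq_sym gtn_eqF.
Qed.

Lemma card_Z (n : nat) : #|'Z_n.+2| = n.+2.
Proof. by rewrite card_ord. Qed.

Lemma cyclic_Z (n : nat) : cyclic [set: 'Z_n]%G.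
Proof. by rewrite /= Zp_cycle cycle_cyclic. Qed.

Section Ratio.
Variable R : realType.

Lemma chowla_ratio_ge1 (n : nat) : 1 <= chowla_ratio R n.+2.
Proof.
rewrite /chowla_ratio ler_pdivlMr ?ltr0n ?totient_gt0 // mul1r ler_nat.
by rewrite -{1}(card_Z n) totient_le_chowla_number ?cyclic_Z ?card_Z.
Qed.

Lemma chowla_ratio_prime (p : nat) : prime p -> chowla_ratio R p = 1.
Proof.
case: p => [|[|n]] // pr_p; apply/eqP; rewrite eq_le chowla_ratio_ge1 andbT.
rewrite /chowla_ratio ler_pdivrMr ?ltr0n ?totient_gt0 // mul1r ler_nat.
rewrite totient_prime //.
by rewrite (leq_trans (chowla_number_le_predn_card _)) // card_Z.
Qed.

Lemma series_harmonic_unbounded (A : R) :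
  exists T : nat, A <= series harmonic T.
Proof.
have nd : nondecreasing_seq (series (@harmonic R)).
  by apply: nondecreasing_series => i _ _; exact: harmonic_ge0.
have /cvgryPge/(_ A)[T _ HT] := nondecreasing_dvgn_lt nd (@dvg_harmonic R).
exists T; exact: HT (leqnn T).
Qed.

(** The witness modulus is a multiple of ((T + B)!)^2, with H_T >= A and
    H_B > T * H_T; the multiple makes it large, and the Chowla set is the set
    of the elements of order at least n / T. *)
Lemma chowla_ratio_unbounded (A : R) (N : nat) :
  exists2 n, (N <= n)%N & A <= chowla_ratio R n.+2.
Proof.
(* H_T >= 1 excludes T = 0, for which the set would be empty. *)
have [T AT] := series_harmonic_unbounded (Num.max A 1).
set HT : R := series harmonic T in AT.
have [AH H1] : A <= HT /\ 1 <= HT by move: AT; rewrite ge_max => /andP.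
have [B HB] := series_harmonic_unbounded (T%:R * HT + 1).
pose M := ((T + B)`!)%N; pose n := (M * M * N.+2)%N.
have M_gt0 : (0 < M)%N by exact: fact_gt0.
have leNn : (N.+2 <= n)%N by rewrite leq_pmull // muln_gt0 M_gt0.
have sqn (g : nat) : (0 < g <= T + B)%N -> (g * g %| n)%N.
  by move=> g_le; rewrite dvdn_mulr // dvdn_mul // dvdn_fact.
have [k Dk] : exists k, n = k.+2 by exists n.-2; case: (n) leNn => [|[]].
exists k; first by rewrite Dk in leNn.
have sqk U : (U <= T + B)%N ->
    forall g : nat, (0 < g <= U)%N -> (g * g %| #|'Z_k.+2|)%N.
  move=> leU g /andP[g_gt0 leg]; rewrite card_Z -Dk sqn // g_gt0.
  exact: leq_trans leg leU.
have cT := card_large_order_set R _ _ (cyclic_Z k.+2) (sqk T (leq_addr _ _)).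
have cB := card_large_order_set R _ _ (cyclic_Z k.+2) (sqk B (leq_addl _ _)).
rewrite card_Z in cT cB; rewrite -/HT in cT.
set S := large_order_set 'Z_k.+2 T in cT.
have phi_gt0 : 0 < (totient k.+2)%:R :> R by rewrite ltr0n totient_gt0.
(* Both sets are counted in units of phi(n), and the larger one fits in the
   group. *)
have ltST : (#|S| * T < k.+2)%N.
  apply: (@leq_trans #|large_order_set 'Z_k.+2 B|); last first.
    by rewrite -[X in (_ <= X)%N]card_Z max_card.
  rewrite -(ltr_nat R) natrM cT cB -mulrA ltr_pM2l // mulrC.
  by apply: lt_le_trans HB; rewrite ltrDl.
have S_chowla : chowla_set S.
  apply/andP; split.
    rewrite -card_gt0 -(ltr_nat R) cT mulr_gt0 //; exact: lt_le_trans H1.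
  apply/forall_inP => x; rewrite inE card_Z => xS.
  by have := leq_trans ltST xS; rewrite ltn_mul2r => /andP[].
apply: (le_trans AH); rewrite /chowla_ratio ler_pdivlMr // mulrC -cT ler_nat.
exact: leq_chowla_number.
Qed.

End Ratio.

Local Open Scope classical_set_scope.
Local Open Scope ring_scope.

Section Limits.
Variables (R : realType) (u : (\bar R)^nat).
Local Open Scope ereal_scope.

Lemma limn_einf_attained (l : \bar R) :
  (forall n, l <= u n) -> (forall N, exists2 n, (N <= n)%N & u n = l) ->
  limn_einf u = l.
Proof.
move=> lbu att; rewrite limn_einf_lim.
suff -> : einfs u = fun=> l by exact: lim_cst.
apply/funext => N; apply/eqP; rewrite eq_le; apply/andP; split.
  by have [n Nn <-] := att N; apply: ereal_inf_lbound; exists n.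
by apply: le_ereal_inf_tmp => _ [n _ <-].
Qed.

Lemma limn_esup_unbounded :
  (forall (A : R) N, exists2 n, (N <= n)%N & A%:E <= u n) -> limn_esup u = +oo.
Proof.
move=> unb; rewrite limn_esup_lim.
suff -> : esups u = fun=> +oo by exact: lim_cst.
apply/funext => N; apply/eqyP => A _; have [n Nn leA] := unb A N.
by apply: le_trans leA _; apply: ereal_sup_ubound; exists n.
Qed.

End Limits.

Theorem corollary2p12 (R : realType) :
  let u : nat -> \bar R := fun n => (chowla_ratio R n.+2)%:E in
  [/\ ~ cvg (u n @[n --> \oo]),
      limn_einf u = 1%E
    & limn_esup u = +oo%E].
Proof.
move=> u.
have infu : limn_einf u = 1%E.
  apply: limn_einf_attained => [n|N]; first by rewrite lee_fin chowla_ratio_ge1.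
  have [[|[|p]] // ltNp pr_p] := prime_above N.+2.
  by exists p; [rewrite -2!ltnS ltnW | rewrite /u chowla_ratio_prime].
have supu : limn_esup u = +oo%E.
  apply: limn_esup_unbounded => A N.
  have [n Nn leA] := chowla_ratio_unbounded R A N.
  by exists n; rewrite ?lee_fin.
split=> // cvgu.
by have := is_cvg_limn_esupE cvgu; rewrite -(is_cvg_limn_einfE cvgu) infu supu.
Qed.
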